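(* Let $\mathcal H$ be a real Hilbert space, let $C$ be a nonempty open convex subset of $\mathcal H$, let $f\colon C\to\mathbb R$ be convex and twice continuously Fréchet differentiable on $C$, and let $\beta\in\left]0,+\infty\right[$. Then $\nabla f\colon C\to\mathcal H$ is $\beta$-Lipschitz continuous if and only if it is $1/\beta$-cocoercive.
   Context: $\mathcal H$ is a real Hilbert space with scalar product $\langle\cdot\mid\cdot\rangle$ and induced norm $\|\cdot\|$. For a nonempty subset $C$ of $\mathcal H$, an operator $T\colon C\to\mathcal H$, and $\beta\in\left]0,+\infty\right[$: $T$ is $1/\beta$-cocoercive if $\beta\langle x-y\mid Tx-Ty\rangle\ge\|Tx-Ty\|^2$ for all $x,y\in C$, and $T$ is $\beta$-Lipschitz continuous if $\|Tx-Ty\|\le\beta\|x-y\|$ for all $x,y\in C$. *)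

(* Defs.v *)
From HB Require Import structures.
From mathcomp Require Export all_boot all_order all_algebra.
From mathcomp Require Export sesquilinear.
From mathcomp Require Export boolp classical_sets functions reals.
From mathcomp Require Export topology normedtype derive convex.

Set Implicit Arguments.
Unset Strict Implicit.
Unset Printing Implicit Defensive.

Export Order.TTheory GRing.Theory Num.Theory.
Export numFieldNormedType.Exports.

Global Open Scope classical_set_scope.
Global Open Scope ring_scope.

(* A Hilbert space is a complete normed module [H] with a symmetric, positive
   definite form [dot : {dot H for idfun}] satisfying [induces_norm dot]. *)
Definition induces_norm (R : realType) (H : completeNormedModType R)
    (dot : {dot H for idfun}) : Prop :=
  forall x : H, `|x| = Num.sqrt (dot x x).

(* Riesz representer of ['d f x]; it exists and is unique whenever [f] is
   differentiable at [x] and [induces_norm dot] holds. *)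
Definition gradient (R : realType) (H : completeNormedModType R)
    (dot : {dot H for idfun}) (f : H -> R) (x : H) : H :=
  get [set g : H | forall h : H, 'd f x h = dot h g].

(* [B] is the second Frechet derivative of [f] at [x], where the element
   [B] of B(H, B(H, R)) is uncurried into a bounded bilinear form and a bound
   [||L|| <= e] on an operator norm is spelled out as
   [forall h, `|L h| <= e * `|h|]. *)
Definition is_diff2 (R : realType) (H : completeNormedModType R)
    (f : H -> R) (x : H) (B : {biscalar H}) : Prop :=
  (exists M : R, forall u v : H, `|B u v| <= M * `|u| * `|v|) /\
  (forall e : R, 0 < e -> \forall u \near (0 : H), forall v : H,
     `|'d f (x + u) v - 'd f x v - B u v| <= e * `|u| * `|v|).

(* Continuity of [x |-> D2 x] is with respect to the operator norm.  Functions
   are total, but for open [C] only the values of [f] on [C] matter. *)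
Definition C2_on (R : realType) (H : completeNormedModType R)
    (C : set H) (f : H -> R) : Prop :=
  (forall x : H, C x -> differentiable f x) /\
  exists D2 : H -> {biscalar H},
    (forall x : H, C x -> is_diff2 f x (D2 x)) /\
    (forall x : H, C x -> forall e : R, 0 < e ->
       \forall y \near within C (nbhs x), forall u v : H,
         `|D2 y u v - D2 x u v| <= e * `|u| * `|v|).

(* [T] is [1/beta]-cocoercive on [C]. *)
Definition inv_cocoercive (R : realType) (H : completeNormedModType R)
    (dot : {dot H for idfun}) (beta : R) (C : set H) (T : H -> H) : Prop :=
  forall x y : H, C x -> C y ->
    `|T x - T y| ^+ 2 <= beta * dot (x - y) (T x - T y).

(* Main.v *)
(* If the gradient is Lipschitz, then each second derivative [D = D2 z] is a
   symmetric form with [0 <= D v v <= beta |v|^2].  With [u = x - y] and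
   [v = gradient f x - gradient f y], expanding
   [0 <= D (beta u - v) (beta u - v)] gives
   [D u v <= beta / 2 * D u u + |v|^2 / 2] at every point of the segment; the
   mean value theorem along the segment turns this into
   [|v|^2 <= beta / 2 * dot u v + |v|^2 / 2], which is cocoercivity.  The
   converse is the Cauchy-Schwarz inequality.  Symmetry and positivity of [D]
   are both read off from second differences of [f]. *)
Require Import Defs.
From mathcomp Require Import interval_inference ring lra.

(** * Inner product identities, the Cauchy-Schwarz inequality and Riesz representation *)

Section RealInnerProduct.
Set Implicit Arguments.
Unset Strict Implicit.
Context (R : realType) (H : completeNormedModType R).
Context (dot : {dot H for idfun}) (dotN : induces_norm dot).

Lemma dotC x y : dot x y = dot y x.
Proof. by rewrite hermC expr0 mul1r. Qed.

Lemma dotZl a x y : dot (a *: x) y = a * dot x y.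
Proof. by rewrite linearZl_LR. Qed.

Lemma dotZr a x y : dot x (a *: y) = a * dot x y.
Proof. by rewrite linearZr_LR. Qed.

Lemma dotxx x : dot x x = `|x| ^+ 2.
Proof.
rewrite dotN sqr_sqrtr//; have [->|x0] := eqVneq x 0; first by rewrite linear0l.
exact/ltW/neq0_dnorm_gt0.
Qed.

Lemma sqr_normD x y : `|x + y| ^+ 2 = `|x| ^+ 2 + 2 * dot x y + `|y| ^+ 2.
Proof. by rewrite -!dotxx linearDl !linearDr /= (dotC y x); ring. Qed.

Lemma sqr_normB x y : `|x - y| ^+ 2 = `|x| ^+ 2 - 2 * dot x y + `|y| ^+ 2.
Proof. by rewrite sqr_normD normrN linearNr/=; ring. Qed.

(** Cauchy-Schwarz: for nonzero vectors, expand the squared norm of [|y| x - |x| y], which is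
    nonnegative, and cancel [|x| |y|]. *)
Lemma dot_le_normM x y : dot x y <= `|x| * `|y|.
Proof.
have [->|x0] := eqVneq x 0; first by rewrite linear0l normr0 mul0r.
have [->|y0] := eqVneq y 0; first by rewrite linear0r normr0 mulr0.
have xy0 : 0 < `|x| * `|y| by rewrite mulr_gt0 ?normr_gt0.
have := sqr_ge0 `| `|y| *: x - `|x| *: y |.
rewrite sqr_normB !normrZ !normr_id dotZl dotZr => h.
rewrite -(ler_pM2l xy0); nra.
Qed.

(* The representer minimizes [x |-> |x|^2 / 2 - L x]; by the parallelogram
   identity, the sublevel sets just above the infimum form a Cauchy filter. *)
Lemma riesz_representation (L : {linear H -> R}) :
  continuous L -> exists g, forall h, L h = dot h g.
Proof.
move=> Lcont.
have [M M0 LM] : exists2 M, 0 <= M & forall x, `|L x| <= M * `|x|.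
  have /linear_boundedP/pinfty_ex_gt0[M M0 LM] :=
    @continuous_linear_bounded _ _ _ 0 L (Lcont 0).
  by exists M => //; exact: ltW.
have LD x a y : L (x + a *: y) = L x + a * L y by rewrite linearD linearZ.
pose q x := `|x| ^+ 2 / 2 - L x.
have q_inf : has_inf (range q).
  split; first by exists (q 0), 0.
  (* Completing the square: [q x >= |x|^2 / 2 - M |x| = (|x| - M)^2 / 2 - M^2 / 2]. *)
  exists (- (M ^+ 2 / 2)) => _ [x _ <-].
  have := LM x; rewrite ler_norml => /andP[_ Lx].
  have := sqr_ge0 (`|x| - M); rewrite /q; nra.
have [m qm m_inf] : exists2 m,
    forall x, m <= q x & forall e, 0 < e -> exists x, q x < m + e.
  exists (inf (range q)) => [x|e e0].
    by apply: ge_inf; [exact: q_inf.2|exists x].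
  by have [_ [x _ <-] qx] := inf_adherent e0 q_inf; exists x.
have q_mid x y : `|x - y| ^+ 2 <= 4 * (q x + q y) - 8 * m.
  have := qm (2^-1 *: (x + y)).
  have -> : q (2^-1 *: (x + y)) = `|x + y| ^+ 2 / 8 - (L x + L y) / 2.
    by rewrite /q normrZ ger0_norm// linearZ linearD/= /GRing.scale/=; field.
  rewrite /q sqr_normD sqr_normB; lra.
pose F := filter_from [set e : R | 0 < e] (fun e => [set x | q x < m + e]).
have F_filter : ProperFilter F.
  apply: filter_from_proper.
    apply: filter_from_filter; first by exists 1 => /=.
    move=> e1 e2 /= e10 e20; exists (Num.min e1 e2); rewrite /= ?lt_min ?e10//.
    by move=> x /= qx; split; apply: (lt_le_trans qx);
      rewrite lerD2l ge_min lexx ?orbT.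
  by move=> e /= e0; have [x qx] := m_inf _ e0; exists x.
have F_cauchy : cauchy F.
  apply: cauchy_exP => e e0.
  (* [q_mid] makes two points with [q < m + e^2 / 8] lie at squared distance below
     [8 * (e^2 / 8)]. *)
  have d0 : 0 < e ^+ 2 / 8 by rewrite divr_gt0 ?exprn_gt0.
  have [x qx] := m_inf _ d0.
  exists x; exists (e ^+ 2 / 8) => //= y /= qy; rewrite -ball_normE/=.
  rewrite -(ltr_pXn2r (_ : 0 < 2)%N) ?nnegrE ?(ltW e0)//.
  by apply: (le_lt_trans (q_mid x y)); lra.
have [g Fg] : exists g : H, F --> g by exists (lim F); exact: cauchy_cvg.
have q_cont : {for g, continuous q}.
  apply: cvgB; last exact: Lcont.
  by apply: cvgMr_tmp; apply: cvgM; apply: cvg_norm; exact: cvg_id.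
(* The closed condition [q <= m + e] holds eventually along [F] for each [e > 0], so the limit [g]
   attains the infimum. *)
have qg x : q g <= q x.
  apply: le_trans (qm x); apply/ler_addgt0Pr => e e0.
  have F_le : \forall z \near F, q z <= m + e by exists e => // y /ltW.
  exact: (closed_cvg _ (@closed_le _ (m + e)) F_le _ (cvg_comp _ _ Fg q_cont)).
exists g => h; apply/eqP; rewrite dotC eq_sym -subr_eq0 -sqrf_eq0.
set d := dot g h - L h; rewrite eq_le sqr_ge0 andbT.
have K0 : 0 < `|h| ^+ 2 + 1 by rewrite ltr_wpDl ?sqr_ge0.
(* Moving from [g] by [- c d h] changes [q] by [- c (1 + c) d^2 / 2], so minimality forces [d = 0].
   The 1 in the denominator covers [h = 0]. *)
pose c := (`|h| ^+ 2 + 1)^-1.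
have c0 : 0 < c by rewrite invr_gt0.
have cK : c * `|h| ^+ 2 = 1 - c by rewrite /c; field; exact: lt0r_neq0.
have := qg (g + (- (c * d)) *: h).
have -> : q (g + (- (c * d)) *: h) = q g - c * d ^+ 2 + (c * d * `|h|) ^+ 2 / 2.
  rewrite /q sqr_normD dotZr normrZ exprMn real_normK ?num_real//.
  by rewrite LD /d; field.
move=> qgh.
have : 0 <= c * (- 2 * d ^+ 2 + (c * `|h| ^+ 2) * d ^+ 2) by lra.
rewrite cK pmulr_rge0//; have := sqr_ge0 d; nra.
Qed.

End RealInnerProduct.

(** * Derivatives along lines and the mean value theorem on the unit interval *)

Section RealCalculus.
Set Implicit Arguments.
Unset Strict Implicit.
Context (R : realType) (H : completeNormedModType R).
Implicit Types (f : H -> R) (B : {biscalar H}).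

Lemma mvt01 (g dg : R -> R) :
    (forall t : R, 0 <= t <= 1 -> is_derive t 1 g (dg t)) ->
  exists2 c : R, 0 <= c <= 1 & g 1 - g 0 = dg c.
Proof.
move=> g_dg.
have g_cont : {within `[0, 1], continuous g}.
  apply: derivable_within_continuous => t; rewrite in_itv/= => t01.
  exact: (@ex_derive _ _ _ _ _ _ _ (g_dg t t01)).
have g_dg' (t : R) : t \in `]0, 1[%R -> is_derive t 1 g (dg t).
  by rewrite in_itv/= => /andP[/ltW t0 /ltW t1]; apply: g_dg; rewrite t0.
have [c c01] := MVT_segment ler01 g_dg' g_cont.
by rewrite subr0 mulr1; exists c.
Qed.

Lemma is_derive_line f x u (t d : R) :
  is_derive (x + t *: u) u f d -> is_derive t 1 (fun s : R => f (x + s *: u)) d.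
Proof.
have E : (fun h : R => h^-1 *: (f (x + (h *: 1 + t) *: u) - f (x + t *: u)))
       = fun h => h^-1 *: (f (h *: u + (x + t *: u)) - f (x + t *: u)).
  by apply/funext => h; rewrite [h *: 1]mulr1 scalerDl addrCA.
by move=> [df <-]; split; rewrite /derivable /derive /= E.
Qed.

Lemma is_derive_differentiable f x u :
  differentiable f x -> is_derive x u f ('d f x u).
Proof. by move=> fx; split; [exact: diff_derivable|exact: deriveE]. Qed.

Lemma is_diff2P f x B : is_diff2 f x B -> forall e, 0 < e ->
  exists2 d, 0 < d & forall u v, `|u| < d ->
    `|'d f (x + u) v - 'd f x v - B u v| <= e * `|u| * `|v|.
Proof.
move=> [_ fB] e e0; have /nbhs_norm0P[d /= d0 fd] := fB e e0.
by exists d => // u v ud; exact: fd.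
Qed.

Lemma is_derive_diff f x B u v :
  is_diff2 f x B -> is_derive x u (fun z => 'd f z v) (B u v).
Proof.
move=> fB.
suff cvgB : (h^-1 *: ('d f (h *: u + x) v - 'd f x v)) @[h --> (0 : R)^']
    --> B u v.
  by split; [apply/cvg_ex; exists (B u v)|exact: cvg_lim].
apply/cvgrPdist_le => e e0.
(* [K] serves two estimates: [|h| < d / K] gives [|h u| < d], and [e / K * |u| |v| <= e]. The 1
   keeps it positive. *)
pose K := `|u| * `|v| + `|u| + 1.
have K0 : 0 < K by rewrite ltr_wpDl ?addr_ge0 ?mulr_ge0.
have [d d0 fd] := is_diff2P fB (divr_gt0 e0 K0).
near=> h.
have h0 : h != 0 by near: h; exact: nbhs_dnbhs_neq.
have hu : `|h *: u| < d.
  rewrite normrZ.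
  have hd : `|h| < d / K.
    by near: h; apply: dnbhs0_lt; rewrite divr_gt0.
  apply: (@le_lt_trans _ _ (`|h| * K)); last by rewrite -ltr_pdivlMr.
  by rewrite ler_wpM2l// /K addrAC lerDr addr_ge0 ?mulr_ge0.
have uvK : e / K * (`|u| * `|v|) <= e.
  rewrite -mulrA ler_piMr ?(ltW e0)// mulrC ler_pdivrMr// mul1r /K -addrA.
  by rewrite lerDl addr_ge0.
have hB : h * B u v = B (h *: u) v by rewrite linearZl_LR.
rewrite -(ler_pM2l (_ : 0 < `|h|)) ?normr_gt0// -normrM.
rewrite mulrBr hB [h * (_ *: _)]mulrA divff// mul1r distrC [h *: u + x]addrC.
apply: (le_trans (fd _ v hu)); rewrite normrZ.
rewrite (_ : _ * _ * _ = `|h| * (e / K * (`|u| * `|v|))); last by ring.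
by rewrite ler_wpM2l.
Unshelve. all: by end_near. Qed.

End RealCalculus.

(** * Second differences; symmetry and positivity of the second derivative *)

Section SecondDerivative.
Set Implicit Arguments.
Unset Strict Implicit.
Context (R : realType) (H : completeNormedModType R).
Implicit Types (f : H -> R) (B : {biscalar H}).

(* Mean value theorem for [s |-> f (x + q + s p) - f (x + s p)]. *)
Lemma second_difference f x B :
    (\forall y \near x, differentiable f y) -> is_diff2 f x B ->
  forall e, 0 < e -> exists2 d, 0 < d & forall p q, `|p| + `|q| < d ->
    `|f (x + q + p) - f (x + p) - (f (x + q) - f x) - B q p|
      <= e * (`|p| + `|q|) ^+ 2.
Proof.
move=> /nbhs0P/nbhs_norm0P[d1 /= d10 fx] fB e e0.
(* Half of [e], because remainders arise at both [q + c p] and [c p], and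
   [|q + c p| + |c p| <= 2 (|p| + |q|)]. *)
have [d2 d20 fd] := is_diff2P fB (divr_gt0 e0 (ltr0n R 2)).
exists (Num.min d1 d2) => [|p q]; first by rewrite lt_min d10.
rewrite lt_min => /andP[pq1 pq2].
pose g (s : R) := f (x + q + s *: p) - f (x + s *: p).
pose dg (s : R) := 'd f (x + q + s *: p) p - 'd f (x + s *: p) p.
have le_p s : 0 <= s <= 1 -> `|s *: p| <= `|p|.
  by move=> /andP[s0 s1]; rewrite normrZ ger0_norm// ler_piMl.
have le_qp s : 0 <= s <= 1 -> `|q + s *: p| <= `|p| + `|q|.
  by move=> s01; rewrite (le_trans (ler_normD _ _))// addrC lerD// le_p.
have g_dg (s : R) : 0 <= s <= 1 -> is_derive s 1 g (dg s).
  move=> s01; apply: is_deriveB; apply: is_derive_line;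
    apply: is_derive_differentiable; rewrite -?addrA; apply: fx => /=.
  - exact: le_lt_trans (le_qp _ s01) pq1.
  - by rewrite (le_lt_trans (le_p _ s01))// (le_lt_trans _ pq1)// lerDl.
have [c c01] := mvt01 g_dg.
rewrite /g /dg !scale1r !scale0r !addr0 => ->.
have h1 := fd (q + c *: p) p (le_lt_trans (le_qp _ c01) pq2).
have cp2 : `|c *: p| < d2.
  by rewrite (le_lt_trans (le_p _ c01))// (le_lt_trans _ pq2)// lerDl.
have h2 := fd (c *: p) p cp2.
have BE : B (q + c *: p) p = B q p + B (c *: p) p by rewrite linearDl.
rewrite addrA in h1.
set a1 := 'd f _ p in h1 *; set a2 := 'd f (x + c *: p) p in h2 *.
(* Both derivatives are expanded about [x]; the terms ['d f x p] and [B (c p) p] cancel. *)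
have -> : a1 - a2 - B q p
   = (a1 - 'd f x p - B (q + c *: p) p) - (a2 - 'd f x p - B (c *: p) p).
  by rewrite BE; ring.
apply: (le_trans (ler_normB _ _)); apply: (le_trans (lerD h1 h2)).
have XP := le_p c c01; have YPQ := le_qp c c01.
rewrite -mulrDl -mulrDr -!mulrA ler_pM2l// ler_pdivrMl//.
apply: le_trans (_ : (2 * (`|p| + `|q|)) * `|p| <= _).
  by have Q0 := normr_ge0 q; rewrite ler_wpM2r//; lra.
by rewrite -mulrA expr2 ler_pM2l// ler_wpM2l ?addr_ge0// lerDl.
Qed.

(** Removes the remainder [e * K] in the limit arguments below, once the step size [t] has been
    cancelled. *)
Lemma le0_of_le_epsM (a K : R) :
  0 <= K -> (forall e, 0 < e -> a <= e * K) -> a <= 0.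
Proof.
move=> K0 aK; have K1 : 0 < K + 1 by rewrite ltr_wpDl.
apply/ler_addgt0Pr => e e0; rewrite add0r (le_trans (aK _ (divr_gt0 e0 K1)))//.
by rewrite -mulrA ler_piMr ?(ltW e0)// mulrC ler_pdivrMr// mul1r lerDl.
Qed.

(** Taking [p = t v] and [q = t u] makes the remainder quadratic in [t], so that [t^2] can be
    cancelled against the main term. *)
Lemma second_difference_scaled f x B u v :
    (\forall y \near x, differentiable f y) -> is_diff2 f x B ->
  forall e, 0 < e -> \forall t \near 0^'+,
    `|f (x + t *: u + t *: v) - f (x + t *: v) - (f (x + t *: u) - f x)
        - t ^+ 2 * B u v|
      <= t ^+ 2 * (e * (`|u| + `|v|) ^+ 2).
Proof.
move=> fx fB e e0; have [d d0 fd] := second_difference fx fB e0.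
near=> t.
have t0 : 0 < t by near: t; exact: nbhs_right_gt.
have td : t < d / (`|u| + `|v| + 1).
  by near: t; apply: nbhs_right_lt; rewrite divr_gt0// ltr_wpDl// addr_ge0.
have := fd (t *: v) (t *: u).
rewrite linearZl_LR linearZr_LR/= !normrZ gtr0_norm// -mulrDr.
rewrite exprMn [`|v| + `|u|]addrC mulrA -expr2 (mulrCA e); apply.
rewrite ltr_pdivlMr ?ltr_wpDl ?addr_ge0// in td.
by apply: le_lt_trans td; rewrite ler_pM2l// lerDl.
Unshelve. all: by end_near. Qed.

(** The second difference is unchanged when [u] and [v] are swapped, and after division by [t^2] it
    approximates both [B u v] and [B v u]. *)
Lemma diff2_le f x B u v :
    (\forall y \near x, differentiable f y) -> is_diff2 f x B ->
  B u v <= B v u.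
Proof.
move=> fx fB; rewrite -subr_le0.
apply: (@le0_of_le_epsM _ (2 * (`|u| + `|v|) ^+ 2)) => [|e e0].
  by rewrite mulr_ge0// sqr_ge0.
near (0 : R)^'+ => t.
have t0 : 0 < t ^+ 2 by rewrite exprn_gt0//; near: t; exact: nbhs_right_gt.
have : `|f (x + t *: u + t *: v) - f (x + t *: v) - (f (x + t *: u) - f x)
        - t ^+ 2 * B u v| <= t ^+ 2 * (e * (`|u| + `|v|) ^+ 2).
  by near: t; exact: second_difference_scaled.
have : `|f (x + t *: v + t *: u) - f (x + t *: u) - (f (x + t *: v) - f x)
        - t ^+ 2 * B v u| <= t ^+ 2 * (e * (`|v| + `|u|) ^+ 2).
  by near: t; exact: second_difference_scaled.
rewrite (addrAC x) [`|v| + _]addrC !ler_norml => /andP[_ vu] /andP[uv _].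
rewrite -(ler_pM2l t0); lra.
Unshelve. all: by end_near. Qed.

Lemma diff2C f x B u v :
    (\forall y \near x, differentiable f y) -> is_diff2 f x B ->
  B u v = B v u.
Proof. by move=> fx fB; apply: le_anti; rewrite !(diff2_le _ _ fx fB). Qed.

(** Midpoint convexity: [x + y] is the midpoint of [x] and [x + y + y]. *)
Lemma convex_second_difference_ge0 (C : set H) f x y :
    convex_function C f -> C x -> C (x + y + y) ->
  0 <= f (x + y + y) - f (x + y) - (f (x + y) - f x).
Proof.
move=> fconvex Cx Cy.
have h0 : 0 <= 2^-1 :> R by rewrite invr_ge0.
have h1 : 2^-1 <= 1 :> R by rewrite invf_le1// ler1n.
have hE : 1 - 2^-1 = 2^-1 :> R by field.
have Exy : 2^-1 *: x + (1 - 2^-1) *: (x + y + y) = x + y.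
  rewrite hE !scalerDr !addrA -scalerDl -addrA -scalerDl.
  by rewrite (_ : 2^-1 + 2^-1 = 1 :> R) ?scale1r//; field.
have : f (x + y) <= 2^-1 * f x + (1 - 2^-1) * f (x + y + y).
  rewrite -[in leLHS]Exy.
  exact: fconvex (Itv01 h0 h1) _ _ (mem_set Cx) (mem_set Cy).
lra.
Qed.

(** For small [t] the point [x + 2 t u] stays in the open set [C], so the second difference is
    nonnegative; it equals [t^2 * B u u] up to [e t^2 (2 |u|)^2]. *)
Lemma convex_diff2_ge0 (C : set H) f x B u :
    open C -> convex_function C f -> (forall y, C y -> differentiable f y) ->
  C x -> is_diff2 f x B -> 0 <= B u u.
Proof.
move=> Copen fconvex fdiff Cx fB.
have nearC : \forall y \near x, C y by exact: open_nbhs_nbhs.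
have fx : \forall y \near x, differentiable f y.
  by apply: filterS nearC => y /fdiff.
rewrite -oppr_le0.
apply: (@le0_of_le_epsM _ ((`|u| + `|u|) ^+ 2)) => [|e e0].
  exact: sqr_ge0.
have cvgx : x + t *: u + t *: u @[t --> (0 : R)] --> x.
  rewrite -[in X in _ --> X](addr0 x) -[in X in _ --> X](addr0 (x + 0)).
  rewrite -(scale0r u).
  apply: cvgD; [apply: cvgD; first exact: cvg_cst|];
    by apply: cvgZr_tmp; exact: cvg_id.
near (0 : R)^'+ => t.
have t0 : 0 < t ^+ 2 by rewrite exprn_gt0//; near: t; exact: nbhs_right_gt.
have Cxt : C (x + t *: u + t *: u).
  near: t; exact: (cvg_at_right_filter cvgx) nearC.
have := convex_second_difference_ge0 fconvex Cx Cxt.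
have : `|f (x + t *: u + t *: u) - f (x + t *: u) - (f (x + t *: u) - f x)
        - t ^+ 2 * B u u| <= t ^+ 2 * (e * (`|u| + `|u|) ^+ 2).
  by near: t; exact: second_difference_scaled.
rewrite ler_norml => /andP[_ vu] uv.
rewrite -(ler_pM2l t0); lra.
Unshelve. all: by end_near. Qed.

End SecondDerivative.

(** * The gradient and the upper bound on the second derivative *)

Section GradientMap.
Set Implicit Arguments.
Unset Strict Implicit.
Context (R : realType) (H : completeNormedModType R).
Context (dot : {dot H for idfun}) (dotN : induces_norm dot).
Implicit Types (f : H -> R) (B : {biscalar H}).

(** Riesz representation shows that the set in [gradient] is inhabited, so [get] returns a true
    representer and not a default value. *)
Lemma gradientE f x h :
  differentiable f x -> 'd f x h = dot h (gradient dot f x).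
Proof.
move=> fx; have [g dfg] := riesz_representation dotN (diff_continuous fx).
exact: (@getPex _ [set g : H | forall h, 'd f x h = dot h g]
  (ex_intro _ _ dfg)).
Qed.

Lemma klipschitzP (k : R) (A : set H) (T : H -> H) :
  k.-lipschitz_A T <->
  forall x y, A x -> A y -> `|T x - T y| <= k * `|x - y|.
Proof.
by split=> [h x y Ax Ay|h [x y] [/= Ax Ay]]; [exact: (h (x, y))|exact: h].
Qed.

(** The increment of ['d f _ v] from [x] to [x + t v] is at most [beta t |v|^2] by Cauchy-Schwarz,
    and equals [t * B v v] up to [e t |v|^2]. *)
Lemma lipschitz_gradient_diff2_le (C : set H) f (beta : R) x B v :
    open C -> (forall y, C y -> differentiable f y) ->
    beta.-lipschitz_C (gradient dot f) -> C x -> is_diff2 f x B ->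
  B v v <= beta * `|v| ^+ 2.
Proof.
move=> Copen fdiff /klipschitzP flip Cx fB; rewrite -subr_le0.
apply: (@le0_of_le_epsM _ _ (`|v| ^+ 2)) => [|e e0]; first exact: sqr_ge0.
have nearC : \forall y \near x, C y by exact: open_nbhs_nbhs.
have cvgx : x + t *: v @[t --> (0 : R)] --> x.
  rewrite -[in X in _ --> X](addr0 x) -(scale0r v).
  by apply: cvgD; [exact: cvg_cst|apply: cvgZr_tmp; exact: cvg_id].
have [d d0 fd] := is_diff2P fB e0.
near (0 : R)^'+ => t.
have t0 : 0 < t by near: t; exact: nbhs_right_gt.
have Cxt : C (x + t *: v) by near: t; exact: (cvg_at_right_filter cvgx) nearC.
have tv : `|t *: v| < d.
  have td : t < d / (`|v| + 1).
    by near: t; apply: nbhs_right_lt; rewrite divr_gt0// ltr_wpDl.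
  rewrite ltr_pdivlMr ?ltr_wpDl// in td.
  by rewrite normrZ gtr0_norm// (le_lt_trans _ td)// ler_pM2l// lerDl.
have := fd _ v tv.
have BE : B (t *: v) v = t * B v v by rewrite linearZl_LR.
have gradE : 'd f (x + t *: v) v - 'd f x v
    = dot v (gradient dot f (x + t *: v) - gradient dot f x).
  by rewrite !gradientE ?linearBr//; exact: fdiff.
have := flip _ _ Cxt Cx; rewrite addrAC subrr add0r normrZ gtr0_norm// => lip.
have := dot_le_normM dotN v (gradient dot f (x + t *: v) - gradient dot f x).
move=> /le_trans/(_ (ler_wpM2l (normr_ge0 v) lip)).
rewrite -gradE BE ler_norml => up /andP[lo _].
rewrite -(ler_pM2l t0); lra.
Unshelve. all: by end_near. Qed.

End GradientMap.

Theorem theorem3p3 (R : realType) (H : completeNormedModType R)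
    (dot : {dot H for idfun}) (Hdot : induces_norm dot)
    (C : set H) (C_nonempty : C !=set0) (C_open : open C)
    (C_convex : convex_set C)
    (f : H -> R) (f_convex : convex_function C f) (f_C2 : C2_on C f)
    (beta : R) (beta_gt0 : 0 < beta) :
  beta.-lipschitz_C (gradient dot f) <->
  inv_cocoercive dot beta C (gradient dot f).
Proof.
have [fdiff [D [fD _]]] := f_C2.
split=> [flip|fcoco]; last first.
  apply/klipschitzP => x y Cx Cy; have := fcoco x y Cx Cy.
  set v := gradient dot f x - gradient dot f y.
  (* For nonzero [v], cancel [|v|] in [|v|^2 <= beta |x - y| |v|]. *)
  have [->|v0] := eqVneq v 0; first by rewrite normr0 mulr_ge0// ltW.
  move=> vxy; rewrite -(ler_pM2r (_ : 0 < `|v|)) ?normr_gt0// -expr2 -mulrA.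
  by rewrite (le_trans vxy)// ler_pM2l// dot_le_normM.
move=> x y Cx Cy; set u := x - y; set v := gradient dot f x - gradient dot f y.
have Cline (s : R) : 0 <= s <= 1 -> C (y + s *: u).
  move=> /andP[s0 s1].
  have := C_convex x y (Itv01 s0 s1) (mem_set Cx) (mem_set Cy).
  rewrite inE /conv/= [unstable.onem _](_ : _ = 1 - s)//.
  by rewrite scalerBl scale1r addrCA -scalerBr.
(* The bound on [D u v] is arranged as a bound on [D z u] at one vector independent of [z]. *)
have D_uv z : C z -> D z u (beta / 2 *: u - v) >= - (`|v| ^+ 2 / 2).
  move=> Cz; have fDz := fD z Cz.
  have fz : \forall y \near z, differentiable f y.
    by apply: filterS (open_nbhs_nbhs (conj C_open Cz)) => w /fdiff.
  have := convex_diff2_ge0 (beta *: u - v) C_open f_convex fdiff Cz fDz.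
  have := lipschitz_gradient_diff2_le Hdot v C_open fdiff flip Cz fDz.
  have -> : D z (beta *: u - v) (beta *: u - v)
      = beta ^+ 2 * D z u u - 2 * beta * D z u v + D z v v.
    have Bl a p q r : D z (a *: p - q) r = a * D z p r - D z q r.
      by rewrite linearBl linearZl_LR.
    have Br a p q r : D z r (a *: p - q) = a * D z r p - D z r q.
      by rewrite linearBr linearZr_LR.
    rewrite Bl !Br (diff2C v u fz fDz); ring.
  have -> : D z u (beta / 2 *: u - v) = beta / 2 * D z u u - D z u v.
    by rewrite linearBr linearZr_LR.
  (* Insert [Dvv] into [D0] and divide by [2 * beta]. *)
  move=> Dvv D0; rewrite -(ler_pM2l beta_gt0); nra.
(* As [w] is constant along the segment, a single mean value point for ['d f _ w] handles both terms
   of the bound. *)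
pose w := beta / 2 *: u - v.
have dline (s : R) : 0 <= s <= 1 ->
    is_derive s 1 (fun s : R => 'd f (y + s *: u) w) (D (y + s *: u) u w).
  move=> s01; apply: (@is_derive_line _ _ (fun z => 'd f z w)).
  by apply: is_derive_diff; apply/fD/Cline.
have [c c01] := mvt01 dline.
rewrite scale1r scale0r addr0 [y + u]addrC subrK => E.
have := D_uv _ (Cline c c01); rewrite -/w -E.
rewrite !(gradientE Hdot); [|exact: fdiff..].
have <- : dot w v = dot w (gradient dot f x) - dot w (gradient dot f y).
  by rewrite linearBr.
have -> : dot w v = beta / 2 * dot u v - `|v| ^+ 2.
  by rewrite linearBl linearZl_LR/= (dotxx Hdot).
(* What remains is [- |v|^2 / 2 <= beta / 2 * dot u v - |v|^2], which doubles to cocoercivity. *)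
lra.
Qed.
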